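(* Let $\delta>0$, $L>0$, $\lambda>0$, let $f,g$ satisfy assumption (A1), let $u_0\in\,]0,\alpha[\,$, and let $u=u(t,x)$ be a random solution with constant initial data $u_0$ (all recalled in the context). Then at every time $t\ge0$, for every random solution $u(t,\cdot)$, the average velocity of cars $$V^{avg}(t)\doteq\frac{1}{u_0L}\left[\int_{\theta=0}g\bigl(u(t,x)\bigr)\,dx+\int_{\theta=1}f\bigl(u(t,x)\bigr)\,dx\right]$$ satisfies the bound $$V^{avg}(t)\;\le\;\frac{f(u_0)}{u_0}.$$
   Context: In the formula for $V^{avg}$ the integrals range over one spatial period $[0,L]$; $\{\theta=1\}$ is the region where the flux is $f$ (where $u_x(t,x)>-\delta$) and $\{\theta=0\}$ is the region where the flux is $g$ (where $u_x(t,x)<-\delta$); points where $u_x=-\delta$ are assigned to one of the two regions. Assumption (A1): $g(u)=\frac{\beta}{2}u(\alpha-u)$ for constants $\alpha,\beta>0$; $f$ is a $\mathcal C^2$ concave function with $f(0)=g(0)=f(\alpha)=g(\alpha)=0$, $f'(0)=g'(0)$, $f'(\alpha)=g'(\alpha)$, $f(u)>g(u)$ for all $u\in\,]0,\alpha[\,$; and for some $\beta^*>0$ one has $f''(u)\le-\beta^*$ and $g''(u)\le-\beta^*$ for all $u\in\,]0,\alpha[\,$. Equation: $u_t+[\theta(u_x)f(u)+(1-\theta(u_x))g(u)]_x=0$, with $\theta(s)=1$ if $s>-\delta$ and $\theta(s)=0$ if $s<-\delta$; spatially $L$-periodic solutions, $u(t,0)=u(t,L)$, with initial data $u(0,x)=u_0$.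 Weak solution means: $t\mapsto u(t,\cdot)\in L^1_{loc}(\mathbb R)$ is continuous, takes the initial data, and there is a measurable $\Theta$ with values in $[0,1]$, equal to $1$ where $u_x>-\delta$ and to $0$ where $u_x<-\delta$, such that $u_t+[\Theta f(u)+(1-\Theta)g(u)]_x=0$ in the sense of distributions. Functions on $[0,L]$ are extended by $L$-periodicity. Admissible profiles: $\mathcal S$ is the set of functions $w:[0,L]\to\mathbb R$ such that: (P1) $w$ has finitely many upward jumps, at points $y_k\in[0,L[\,$, and on each open interval $I_k$ between two consecutive jumps $w$ is $\mathcal C^1$ and non-increasing; (P2) $w(0)=w(L)$, $\frac1L\int_0^Lw\,dx=u_0$, $0<\inf w\le\sup w<\alpha$; (P3) if $w_x(x)\le-\delta$ at some $x\in I_k$, then $w_x$ is constant on $I_k$. Random data: $0<t_1<t_2<\cdots$ is a Poisson arrival process with rate $\lambda$ (with $t_0=0$, the increments $t_j-t_{j-1}$ are i.i.d. with $\mathrm{Prob}\{t_j-t_{j-1}>s\}=e^{-\lambda s}$), and the $X_j$ are independent, uniformly distributed on $[0,L]$ (and independent of the times). Random solution: for each sequence $(t_j,X_j)_{j\ge1}$ with $t_j\to+\infty$ (hence almost surely), $u$ is the unique weak solution with $u(t,\cdot)\in\mathcal S$ for all $t\ge0$ satisfying: (I) $u(t,x)=u_0$ on $[0,t_1]$; (II) given $u$ on $[0,t_j]$, if $u_x(t_j,X_j)>-\delta$ then $u$ is prolonged to $[t_j,t_{j+1}]$ by inserting a new $N$-shaped spike at $X_j$ at time $t_j$; if $u_x(t_j,X_j)$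 is undefined or $\le-\delta$, then $u$ is prolonged without adding any new spike. Inserting a spike means that for $t>t_j$ close to $t_j$ there are jump curves $y'(t)<y''(t)$, both converging to $X_j$ as $t\to t_j+$, with $u(t,x)=\frac\alpha2-\frac{x-X_j}{\beta(t-t_j)}$ for $y'(t)<x<y''(t)$, while near $X_j$ outside $[y'(t),y''(t)]$ $u$ is the $\mathcal C^1$ solution of $u_t+f(u)_x=0$ continuing the pre-existing profile. No other new jump curves are created; jumps satisfy the Rankine-Hugoniot condition and two jumps which meet merge into one. *)

(* Defs.v *)
From HB Require Import structures.
From mathcomp Require Import all_boot all_order all_algebra.
From mathcomp Require Import all_classical all_reals all_analysis.

Set Implicit Arguments.
Unset Strict Implicit.
Unset Printing Implicit Defensive.

Import Order.TTheory GRing.Theory Num.Theory.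
Import numFieldNormedType.Exports.

Local Open Scope classical_set_scope.
Local Open Scope ring_scope.

(* L-periodic functions of the space variable are represented by their
   periodic extension R -> R; a function of time and space is u : R -> R -> R,
   with the time variable first. *)

(* f is a function on the whole line; only its values on [0, alpha] are
   relevant, and every C^2 function on [0, alpha] has a C^2 extension. *)
Record assumptionA1 (R : realType) (alpha beta : R) (f g : R -> R) : Prop := {
  A1_alpha : 0 < alpha ;
  A1_beta : 0 < beta ;
  A1_g : forall v, g v = beta / 2 * v * (alpha - v) ;
  A1_fC1 : forall v, derivable f v 1 ;
  A1_fC2 : forall v, derivable (derive1 f) v 1 ;
  A1_fC2c : continuous (derive1 (derive1 f)) ;
  A1_concave : convex_function (E := R^o) `[0, alpha] (fun v : R => - f v) ;
  A1_f0 : f 0 = 0 ;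
  A1_g0 : g 0 = 0 ;
  A1_fa : f alpha = 0 ;
  A1_ga : g alpha = 0 ;
  A1_d0 : derive1 f 0 = derive1 g 0 ;
  A1_da : derive1 f alpha = derive1 g alpha ;
  A1_gf : forall v, 0 < v < alpha -> g v < f v ;
  A1_bstar : exists2 bstar, 0 < bstar & forall v, 0 < v < alpha ->
      derive1 (derive1 f) v <= - bstar /\ derive1 (derive1 g) v <= - bstar }.

Definition jump (R : realType) (w : R -> R) (x : R) : Prop :=
  exists l r, [/\ l < r, w y @[y --> x^'-] --> l & w y @[y --> x^'+] --> r].

(* The intervals I_k are the maximal jump-free open intervals of the periodic
   extension; P1 and P3 hold on these iff they hold on every bounded jump-free
   open interval. The latter form also covers profiles without jumps. *)
Definition jump_free (R : realType) (w : R -> R) (a b : R) : Prop :=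
  forall x, a < x < b -> ~ jump w x.

Record profile (R : realType) (L delta alpha u0 : R) (w : R -> R) : Prop := {
  P1_finite : finite_set [set y | 0 <= y < L /\ jump w y] ;
  P1_derivable : forall a b, jump_free w a b ->
    forall x, a < x < b -> derivable w x 1 ;
  P1_continuous : forall a b, jump_free w a b ->
    forall x, a < x < b -> {for x, continuous (derive1 w)} ;
  P1_nonincreasing : forall a b, jump_free w a b ->
    {in `]a, b[ &, nonincreasing_fun w} ;
  P2_periodic : forall x, w (x + L) = w x ;
  P2_mean : L^-1 * (\int[lebesgue_measure]_(x in `[0, L]) w x) = u0 ;
  P2_lbound : has_lbound (range w) ;
  P2_ubound : has_ubound (range w) ;
  P2_inf : 0 < inf (range w) ;
  P2_sup : sup (range w) < alpha ;
  P3 : forall a b, jump_free w a b ->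
    forall x, a < x < b -> derive1 w x <= - delta ->
    forall y, a < y < b -> derive1 w y = derive1 w x }.

Definition dt (R : realType) (phi : R -> R -> R) : R -> R -> R :=
  fun t x => derive1 (phi ^~ x) t.

Definition dx (R : realType) (phi : R -> R -> R) : R -> R -> R :=
  fun t x => derive1 (phi t) x.

Fixpoint iter_partial (R : realType) (s : seq bool) (phi : R -> R -> R) :
    R -> R -> R :=
  if s is b :: s' then
    if b then dt (iter_partial s' phi) else dx (iter_partial s' phi)
  else phi.

Definition smooth2 (R : realType) (phi : R -> R -> R) : Prop :=
  forall s : seq bool,
    continuous (fun p : R * R => iter_partial s phi p.1 p.2) /\
    forall t x, derivable (iter_partial s phi ^~ x) t 1 /\
                derivable (iter_partial s phi t) x 1.

(* C^oo functions with compact support in ]0, +oo[ x R. *)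
Definition test_function (R : realType) (phi : R -> R -> R) : Prop :=
  smooth2 phi /\
  exists a b M, 0 < a /\
    forall t x, ~ (a <= t <= b /\ - M <= x <= M) -> phi t x = 0.

Definition flux (R : realType) (f g : R -> R) (Theta u : R -> R -> R)
    (t x : R) : R :=
  Theta t x * f (u t x) + (1 - Theta t x) * g (u t x).

Record weak_solution (R : realType) (f g : R -> R) (delta u0 : R)
    (Theta u : R -> R -> R) : Prop := {
  ws_measurable :
    measurable_fun [set p : R * R | 0 <= p.1] (fun p => u p.1 p.2) ;
  ws_L1loc : forall t a b, 0 <= t ->
    lebesgue_measure.-integrable `[a, b] (EFin \o u t) ;
  ws_continuous : forall s a b, 0 <= s ->
    (fun t => \int[lebesgue_measure]_(x in `[a, b]) `|u t x - u s x|)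
      @ within [set t | 0 <= t] (nbhs s) --> (0 : R) ;
  ws_init : {ae lebesgue_measure, forall x, u 0 x = u0} ;
  ws_Theta_measurable :
    measurable_fun [set p : R * R | 0 < p.1] (fun p => Theta p.1 p.2) ;
  ws_Theta_01 : forall t x, 0 < t -> 0 <= Theta t x <= 1 ;
  ws_Theta_1 : forall t x, 0 < t -> derivable (u t) x 1 ->
    - delta < derive1 (u t) x -> Theta t x = 1 ;
  ws_Theta_0 : forall t x, 0 < t -> derivable (u t) x 1 ->
    derive1 (u t) x < - delta -> Theta t x = 0 ;
  ws_eq : forall phi, test_function phi ->
    \int[(lebesgue_measure \x lebesgue_measure)%E]_(p in
         [set p : R * R | 0 < p.1])
      (u p.1 p.2 * dt phi p.1 p.2
       + flux f g Theta u p.1 p.2 * dx phi p.1 p.2) = 0 }.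

(* v is a C^1 solution of v_t + f(v)_x = 0 for |t - tau| < eps,
   |x - xi| < r. *)
Definition classical_solution (R : realType) (f : R -> R) (tau xi eps r : R)
    (v : R -> R -> R) : Prop :=
  forall t x, `|t - tau| < eps -> `|x - xi| < r ->
    [/\ derivable (v ^~ x) t 1 /\ derivable (v t) x 1,
        {for (t, x), continuous (fun p : R * R => dt v p.1 p.2)},
        {for (t, x), continuous (fun p : R * R => dx v p.1 p.2)} &
        dt v t x + derive1 (fun y => f (v t y)) x = 0].

(* v is the local C^1 solution with data u(tau, .): it is given near
   (tau, xi), in both time directions, by the method of characteristics, and
   it is only compared with u for t > tau. *)
Definition spike (R : realType) (f : R -> R) (alpha beta : R)
    (u : R -> R -> R) (tau xi : R) (y1 y2 : R -> R) : Prop :=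
  [/\ y1 t @[t --> tau^'+] --> xi, y2 t @[t --> tau^'+] --> xi &
   exists eps r v,
    [/\ 0 < eps /\ 0 < r,
        classical_solution f tau xi eps r v,
        forall x, `|x - xi| < r -> v tau x = u tau x &
        forall t, tau < t < tau + eps ->
        [/\ y1 t < y2 t,
            jump (u t) (y1 t) /\ jump (u t) (y2 t),
            forall x, y1 t < x < y2 t ->
              u t x = alpha / 2 - (x - xi) / (beta * (t - tau)) &
            forall x, `|x - xi| < r -> x < y1 t \/ y2 t < x ->
              u t x = v t x]]].

(* A spike is inserted at the j-th arrival (j >= 1). *)
Definition spiked (R : realType) (delta : R) (ts X : nat -> R)
    (u : R -> R -> R) (j : nat) : Prop :=
  [/\ (0 < j)%N, derivable (u (ts j)) (X j) 1 &
      - delta < derive1 (u (ts j)) (X j)].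

Definition rankine_hugoniot (R : realType) (f g : R -> R)
    (Theta u : R -> R -> R) (y : R -> R) (t : R) : Prop :=
  exists ul ur Fl Fr,
    [/\ u t x @[x --> (y t)^'-] --> ul /\ u t x @[x --> (y t)^'+] --> ur,
        flux f g Theta u t x @[x --> (y t)^'-] --> Fl,
        flux f g Theta u t x @[x --> (y t)^'+] --> Fr,
        derivable y t 1 &
        derive1 y t * (ur - ul) = Fr - Fl].

(* c j false and c j true are the jump curves y', y'' issuing from the j-th
   spike, lifted to the universal cover of the circle R / LZ and followed after
   merging: two curves which have met coincide from then on. Jump curves are
   Lipschitz, with corners where they interact, whence the a.e. quantifier in
   the Rankine-Hugoniot condition. *)
Record path_solution (R : realType) (f g : R -> R)
    (alpha beta delta L u0 : R) (ts X : nat -> R) (Theta u : R -> R -> R)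
    (c : nat -> bool -> R -> R) : Prop := {
  ps_weak : weak_solution f g delta u0 Theta u ;
  ps_profile : forall t, 0 <= t -> profile L delta alpha u0 (u t) ;
  ps_init : forall t x, 0 <= t <= ts 1 -> u t x = u0 ;
  ps_spike : forall j, spiked delta ts X u j ->
    spike f alpha beta u (ts j) (X j) (c j false) (c j true) ;
  ps_curve_continuous : forall j b t, spiked delta ts X u j ->
    ts j < t -> {for t, continuous (c j b)} ;
  ps_jumps : forall t x, 0 <= t ->
    (jump (u t) x <->
     exists j b (k : int),
       [/\ spiked delta ts X u j, ts j < t & x = c j b t + k%:~R * L]) ;
  ps_RH : forall j b, spiked delta ts X u j ->
    {ae lebesgue_measure, forall t, ts j < t ->
       rankine_hugoniot f g Theta u (c j b) t} ;
  ps_merge : forall i j b b' (k : int) s t,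
    spiked delta ts X u i -> spiked delta ts X u j ->
    ts i < s -> ts j < s -> s <= t ->
    c i b s = c j b' s + k%:~R * L -> c i b t = c j b' t + k%:~R * L }.

Definition random_solution (R : realType) (f g : R -> R)
    (alpha beta delta L u0 : R) (ts X : nat -> R) (u : R -> R -> R) : Prop :=
  exists Theta c, path_solution f g alpha beta delta L u0 ts X Theta u c.

Definition mutually_independent (R : realType) (d : measure_display)
    (Omega : measurableType d) (P : probability Omega R) (I : choiceType)
    (Z : I -> Omega -> R) : Prop :=
  forall (s : seq I) (A : I -> set R), uniq s ->
    (forall i, measurable (A i)) ->
    fine (P (\bigcap_(i in [set` s]) Z i @^-1` A i)) =
    \prod_(i <- s) fine (P (Z i @^-1` A i)).

(* X 0 is not used: the arrivals are numbered from 1. *)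
Record random_data (R : realType) (d : measure_display)
    (Omega : measurableType d) (P : probability Omega R) (lambda L : R)
    (T X : nat -> {RV P >-> R}) : Prop := {
  rd_t0 : forall omega, T 0 omega = 0 ;
  rd_increasing : forall j omega, T j omega < T j.+1 omega ;
  rd_exponential : forall j s, 0 <= s ->
    P [set omega | s < T j.+1 omega - T j omega] = (expR (- (lambda * s)))%:E ;
  rd_X_range : forall j omega, 0 <= X j.+1 omega <= L ;
  rd_uniform : forall j (hL : 0 < L) (B : set R), measurable B ->
    distribution P (X j.+1) B = uniform_prob hL B ;
  rd_independent : mutually_independent P
    (fun i : nat + nat => match i with
      | inl j => fun omega => T j.+1 omega - T j omega
      | inr j => fun omega => X j.+1 omega
      end) }.

(* A is the region {theta = 1} of the period [0, L], its complement in [0, L]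
   is {theta = 0}; points with w_x = - delta, as well as the finitely many
   points where w_x is undefined, may belong to either of them. *)
Definition theta_region (R : realType) (L delta : R) (w : R -> R)
    (A : set R) : Prop :=
  [/\ measurable A, A `<=` `[0, L],
      forall x, 0 <= x <= L -> derivable w x 1 ->
        - delta < derive1 w x -> A x &
      forall x, 0 <= x <= L -> derivable w x 1 ->
        derive1 w x < - delta -> ~ A x].

Definition Vavg (R : realType) (f g : R -> R) (L u0 : R) (A : set R)
    (w : R -> R) : R :=
  (u0 * L)^-1 *
  (\int[lebesgue_measure]_(x in `[0, L] `\` A) g (w x)
   + \int[lebesgue_measure]_(x in A) f (w x)).

(* Main.v *)
(** By concavity the graph of [f] lies below its tangent at [u0], and [g <= f]
    on [0, alpha]; hence both integrands are bounded by the affine function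
    [f u0 + f'(u0) (u - u0)].  Its integral over a period is [L f(u0)] because
    [u] has mean [u0]. *)
Require Import Defs.
From HB Require Import structures.
From mathcomp Require Import all_boot all_order all_algebra.
From mathcomp Require Import all_classical all_reals all_analysis.
From mathcomp Require Import measurable_realfun ring lra.

Import Order.TTheory GRing.Theory Num.Theory.
Import numFieldNormedType.Exports.

Local Open Scope classical_set_scope.
Local Open Scope ring_scope.

(** The mean value theorem gives [f y - f x = f'(c) (y - x)] with [c] between [x] and [y], and [f']
    is nonincreasing because [f'' <= 0]. Everything is stated on the open interval, where the bound
    on [f''] in (A1) is available. *)
Lemma le_tangent (R : realType) (f : R -> R) (a b : R) :
  (forall x, a < x < b -> derivable f x 1) ->
  (forall x, a < x < b -> derivable (derive1 f) x 1) ->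
  (forall x, a < x < b -> derive1 (derive1 f) x <= 0) ->
  forall x y, a < x < b -> a < y < b ->
  f y <= f x + derive1 f x * (y - x).
Proof.
move=> df d2f f2_le0 x y xab yab.
have sub_ab p q z : a < p < b -> a < q < b -> z \in `[p, q] -> a < z < b.
  by rewrite in_itv/= => /andP[? ?] /andP[? ?] /andP[? ?]; apply/andP; split; lra.
have f1_nincr p q : a < p < b -> a < q < b -> p <= q ->
    derive1 f q <= derive1 f p.
  move=> pab qab; apply: (@ler0_derive1_le_oo R (derive1 f) a b) => //.
  move=> z; rewrite inE/= in_itv/= => zab.
  by apply/differentiable_continuous/derivable1_diffP/d2f.
have mvt p q : a < p < b -> a < q < b -> p <= q ->
    exists2 c, p <= c <= q & f q - f p = derive1 f c * (q - p).
  move=> pab qab pq.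
  have [||c] := @MVT_segment R f (derive1 f) p q pq; last first.
    by rewrite in_itv /= => cpq ->; exists c.
  - by apply: derivable_within_continuous => z zpq; apply/df/(sub_ab p q).
  - move=> z /subset_itv_oo_cc zpq; rewrite derive1E; apply: DeriveDef => //.
    exact/df/(sub_ab p q).
(* The sign of [y - x] decides on which side of [x] the point [c] lies. The difference
   [f'(x) - f'(c)] has the same sign, so its product with [y - x] is nonnegative in both cases. *)
case: (leP x y) => [xy|/ltW yx].
- have [c /andP[xc cy] fE] := mvt x y xab yab xy.
  have cab : a < c < b by lra.
  have := f1_nincr x c xab cab xc.
  by nra.
- have [c /andP[yc cx] fE] := mvt y x yab xab yx.
  have cab : a < c < b by lra.
  have := f1_nincr c x cab xab cx.
  by nra.
Qed.

(** Monotonicity of the integral on each of the two pieces, where the same affine function of [w]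
    dominates both integrands. The two affine integrals then recombine over [D]. The bounds from
    below by 0 serve integrability. *)
Lemma Rintegral_split_le_affine (d : measure_display) (T : measurableType d)
  (R : realType) (mu : {measure set T -> \bar R}) (D A : set T)
  (f g : R -> R) (w : T -> R) (k m : R) :
  measurable D -> measurable A -> A `<=` D -> (mu D < +oo)%E ->
  mu.-integrable D (EFin \o w) -> continuous f -> continuous g ->
  (forall x, D x -> 0 <= g (w x) <= f (w x)) ->
  (forall x, D x -> f (w x) <= k + m * w x) ->
  \int[mu]_(x in D `\` A) g (w x) + \int[mu]_(x in A) f (w x) <=
  k * fine (mu D) + m * \int[mu]_(x in D) w x.
Proof.
move=> mD mA AD muD iw cf cg gf f_le.
have mw : measurable_fun D w.
  by apply/measurable_EFinP; exact: measurable_int iw.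
have ik : mu.-integrable D (EFin \o cst k).
  apply: measurable_bounded_integrable => //.
  exact: bounded_cst.
have imw : mu.-integrable D (EFin \o (fun x => m * w x)).
  exact: (integrableZl mD m iw).
have iaff : mu.-integrable D (EFin \o (fun x => k + m * w x)).
  exact: (integrableD mD ik imw).
(* For [h (w x) >= 0] the upper bound alone controls the absolute value, and continuity of [h] makes
   the composition measurable. *)
have dominated (h : R -> R) : continuous h ->
    (forall x, D x -> 0 <= h (w x) <= k + m * w x) ->
    mu.-integrable D (EFin \o (h \o w)).
  move=> ch h_le; apply: le_integrable iaff => //.
    apply/measurable_EFinP/measurableT_comp => //.
    exact: continuous_measurable_fun.
  move=> x /h_le/andP[h0 hk] /=.
  by rewrite lee_fin !ger0_norm// (le_trans h0).
have le_affine x : D x -> [/\ 0 <= g (w x), g (w x) <= k + m * w x,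
    0 <= f (w x) & f (w x) <= k + m * w x].
  by move=> Dx; have := gf x Dx; have := f_le x Dx; split; lra.
have ig : mu.-integrable D (EFin \o (g \o w)).
  by apply: dominated => // x /le_affine[? ? ? ?]; apply/andP.
have if_ : mu.-integrable D (EFin \o (f \o w)).
  by apply: dominated => // x /le_affine[? ? ? ?]; apply/andP.
have mDA : measurable (D `\` A) by exact: measurableD.
have DAD : D `\` A `<=` D by move=> x [].
(* Splitting the affine integral along [A] allows a comparison term by term. *)
have -> : k * fine (mu D) + m * \int[mu]_(x in D) w x =
    \int[mu]_(x in D `\` A) (k + m * w x) + \int[mu]_(x in A) (k + m * w x).
  rewrite -Rintegral_setU//; last 2 first.
  - by rewrite setUC setDUK.
  - by apply/disj_setPS => x [[]].
  by rewrite setUC setDUK// RintegralD// RintegralZl// Rintegral_cst.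
apply: lerD; apply: le_Rintegral => //.
- exact: integrableS ig.
- exact: integrableS iaff.
- by move=> x /DAD/le_affine[].
- exact: integrableS if_.
- exact: integrableS iaff.
- by move=> x /AD/le_affine[].
Qed.

Theorem proposition5p1 (R : realType) (alpha beta delta L lambda u0 : R)
  (f g : R -> R) (d : measure_display) (Omega : measurableType d)
  (P : probability Omega R) (T X : nat -> {RV P >-> R})
  (u : Omega -> R -> R -> R) :
  0 < delta -> 0 < L -> 0 < lambda ->
  assumptionA1 alpha beta f g ->
  0 < u0 < alpha ->
  random_data lambda L T X ->
  (forall omega, (fun j => T j omega) @ \oo --> +oo ->
     random_solution f g alpha beta delta L u0
       (fun j => T j omega) (fun j => X j omega) (u omega)) ->
  forall omega, (fun j => T j omega) @ \oo --> +oo ->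
  forall t, 0 <= t ->
  forall A, theta_region L delta (u omega t) A ->
  Vavg f g L u0 A (u omega t) <= f u0 / u0.
Proof.
move=> _ L_gt0 _ hA1 u0a _ hsol omega hT t t_ge0 A [mA AL _ _].
have u0_gt0 : 0 < u0 by case/andP: u0a.
have [? [? []]] := hsol omega hT; move=> hws + _ _ _ _ _ _.
move=> /(_ t t_ge0) hprof.
have iw := ws_L1loc hws 0 L t_ge0.
set w := u omega t in hprof iw *.
(* The strict bounds on the infimum and supremum keep every value in the open interval where [g < f]
   and [f'' <= - bstar]. *)
have w_range x : 0 < w x < alpha.
  apply/andP; split.
  - apply: (lt_le_trans (P2_inf hprof)); apply: ge_inf; last by exists x.
    exact: P2_lbound hprof.
  - apply: le_lt_trans (P2_sup hprof); apply: ub_le_sup; last by exists x.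
    exact: P2_ubound hprof.
have [bstar bstar_gt0 f2_le] := A1_bstar hA1.
(* The tangent at [u0], rewritten as [k + m * w x] with slope [m = f'(u0)]. *)
have tangent x : f (w x) <= (f u0 - derive1 f u0 * u0) + derive1 f u0 * w x.
  suff : f (w x) <= f u0 + derive1 f u0 * (w x - u0) by lra.
  apply: (@le_tangent R f 0 alpha) => // v.
  - by move=> _; exact: (A1_fC1 hA1).
  - by move=> _; exact: (A1_fC2 hA1).
  - by move=> /f2_le[]; lra.
have g_ge0 x : 0 <= g (w x).
  have /andP[w0 wa] := w_range x; rewrite (A1_g hA1).
  by rewrite !mulr_ge0 ?invr_ge0 ?subr_ge0 ?ltW ?(A1_beta hA1).
have cf : continuous f.
  by move=> v; apply/differentiable_continuous/derivable1_diffP/(A1_fC1 hA1).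
have cg : continuous g.
  rewrite (_ : g = fun v => beta / 2 * v * (alpha - v)); last first.
    by apply/funext => v; exact: A1_g hA1 v.
  move=> v; apply: cvgM; first by apply: cvgM; [exact: cvg_cst|exact: cvg_id].
  by apply: cvgB; [exact: cvg_cst|exact: cvg_id].
have muL : lebesgue_measure (`[0, L]%classic : set R) = L%:E.
  by rewrite lebesgue_measure_itv /= lte_fin L_gt0 sube0.
have mean : \int[lebesgue_measure]_(x in `[0, L]) w x = L * u0.
  by rewrite -(P2_mean hprof) mulrA divff ?mul1r ?gt_eqF.
have split_le : \int[lebesgue_measure]_(x in `[0, L] `\` A) g (w x) +
    \int[lebesgue_measure]_(x in A) f (w x) <= L * f u0.
  apply: le_trans (Rintegral_split_le_affine _ _ R lebesgue_measure `[0, L] A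
    f g w _ _ _ mA AL _ iw cf cg _ (fun x _ => tangent x)) _ => //.
  - by rewrite [ltLHS]muL ltry.
  - by move=> x _; rewrite g_ge0 ltW// (A1_gf hA1).
  (* With period length [L] and integral [L * u0], the terms in [f'(u0)] cancel and [L * f u0]
     remains. *)
  - rewrite mean [X in fine X]muL /=; lra.
have Lu0 : f u0 / u0 = (u0 * L)^-1 * (L * f u0).
  by field; rewrite !gt_eqF.
by rewrite /Vavg Lu0 ler_wpM2l// invr_ge0 mulr_ge0// ltW.
Qed.
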